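(* Let $X$ and $Y$ be Banach spaces. If $T\in\mathrm{QNA}(X,Y)$ is a monomorphism, then $T\in\mathrm{NA}(X,Y)$.
   Context: Banach spaces are over $\mathbb{K}=\mathbb{R}$ or $\mathbb{C}$; $B_X$ is the closed unit ball of $X$. For a bounded linear operator $T\colon X\to Y$: $T\in\mathrm{NA}(X,Y)$ if $\|Tx_0\|=\|T\|$ for some $x_0\in B_X$; $T\in\mathrm{QNA}(X,Y)$ if there is $u\in\overline{T(B_X)}$ (norm closure) with $\|u\|=\|T\|$. $T$ is a monomorphism if it is an isomorphism (linear homeomorphism) from $X$ onto $T(X)$; equivalently, there is $C>0$ with $\|Tx\|\geq C\|x\|$ for all $x\in X$. *)

(* Defs.v *)
From mathcomp Require Export all_boot all_order all_algebra.
From mathcomp Require Export all_classical all_reals all_analysis.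
From mathcomp.real_closed Require Export complex.

Set Implicit Arguments.
Unset Strict Implicit.
Unset Printing Implicit Defensive.

Import Order.TTheory GRing.Theory Num.Theory.
Export numFieldNormedType.Exports.

Local Open Scope classical_set_scope.
Local Open Scope ring_scope.

Definition closed_unit_ball (K : numFieldType) (V : normedModType K) : set V :=
  [set x | `|x| <= 1].

Arguments closed_unit_ball {K} V.

Section NormAttainment.
Context {K : numFieldType} {X Y : normedModType K}.

Definition bounded_operator (T : {linear X -> Y}) : Prop :=
  exists M : K, forall x : X, `|T x| <= M * `|x|.

(* Norms take their values in the scalar field K, so the supremum is the one
   of the order of K.  When K = R[i], this order is the partial one in which
   z <= w iff w - z is a nonnegative real; as the norms are nonnegative reals,
   so are their upper bounds, and the supremum is the usual real one. *)
Definition opnorm (T : {linear X -> Y}) : K :=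
  supremum 0 [set `|T x| | x in closed_unit_ball X].

Definition NA : set {linear X -> Y} :=
  [set T | bounded_operator T /\
     exists x0 : X, closed_unit_ball X x0 /\ `|T x0| = opnorm T].

Definition QNA : set {linear X -> Y} :=
  [set T | bounded_operator T /\
     exists u : Y, closure (T @` closed_unit_ball X) u /\ `|u| = opnorm T].

(* S is the inverse of T on the range of T; its values elsewhere are
   irrelevant.  Its linearity on the range follows from that of T. *)
Definition monomorphism (T : {linear X -> Y}) : Prop :=
  continuous T /\
  exists S : Y -> X, cancel T S /\ {within range T, continuous S}.

End NormAttainment.

Arguments NA {K} X Y.
Arguments QNA {K} X Y.

(* Main.v *)
Require Import Defs.
Import Order.TTheory GRing.Theory Num.Theory.

Local Open Scope classical_set_scope.
Local Open Scope ring_scope.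

(** Let [u] be in the closure of [T(B_X)]. The sets [B_X `&` T @^-1` A], for [A]
a neighbourhood of [u], generate a filter on [X]. Since the inverse of [T] is continuous at 0, this filter is
Cauchy, so by completeness of [X] it has a limit [x0], which lies in [B_X] and
is mapped to [u] by continuity of [T]. Hence [T(B_X)] is already closed. *)

(** Plays the part of the lower bound on [|T x|]: by linearity it applies to differences, so close
    images come from close points. *)
Lemma monomorphism_small {K : numFieldType} {X Y : normedModType K}
    {T : {linear X -> Y}} {e : K} :
  monomorphism T -> 0 < e ->
  exists2 d : K, 0 < d & forall x : X, `|T x| < d -> `|x| < e.
Proof.
case=> _ [S [TK /subspace_continuousP S_cont]] e0.
have : within (range T) (nbhs (T 0)) (S @^-1` ball 0 e).
  apply: (S_cont (T 0)); first by exists 0.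
  by have := nbhsx_ballx (0 : X) e e0; rewrite -{1}(TK 0).
move=> /nbhs_ballP[d d0 Td]; exists d => // x Txd.
have /= := Td (T x); rewrite TK -!ball_normE /= linear0 !sub0r !normrN.
by apply => //; exists x.
Qed.

Lemma closed_closed_unit_ball {K : numFieldType} (V : normedModType K) :
  closed (@closed_unit_ball K V).
Proof.
move=> x; rewrite closureEnbhs => x_adh; rewrite /closed_unit_ball /=.
(* The order of [K] may be partial, but norms are real, hence comparable with 1. *)
have [//|x1] := real_leP (normr_real x) (@real1 K).
(* The ball of radius [|x| - 1] around [x] would miss the unit ball. *)
have x10 : 0 < `|x| - 1 by rewrite subr_gt0.
have [y [/= y1]] := x_adh _ _ (fun _ h => h) (nbhsx_ballx x _ x10).
rewrite -ball_normE /= => xy.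
have : `|x| < `|x| - 1 + 1.
  by rewrite -{1}[x](subrK y) (le_lt_trans (ler_normD _ _))// ltr_leD.
by rewrite subrK ltxx.
Qed.

Lemma closed_monomorphism_image_ball {K : numFieldType}
    {X : completeNormedModType K} {Y : normedModType K} {T : {linear X -> Y}} :
  monomorphism T -> closed (T @` closed_unit_ball X).
Proof.
move=> Tmono u u_adh.
pose B A := closed_unit_ball X `&` T @^-1` A.
pose F := filter_from (nbhs u) B.
have F_filter : ProperFilter F.
  apply: filter_from_proper => [|A /u_adh[_ [[x x1 <-] Ax]]]; last by exists x.
  apply: filter_from_filter => [|A1 A2 uA1 uA2]; first by exists setT; exact: filterT.
  by exists (A1 `&` A2); [exact: filterI | move=> x [x1 []]].
have /cvg_ex[x0 Fx0] : cvg F.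
  apply: cauchy_cvg; apply: cauchy_exP => e e0.
  have [d d0 Td] := monomorphism_small Tmono e0.
  (* Two images within [d / 2] of [u] are within [d] of each other, so their preimages are within
     [e]. *)
  have ud : nbhs u (ball u (d / 2)) by apply: nbhsx_ballx; rewrite divr_gt0.
  have [_ [[x x1 <-] ux]] := u_adh _ ud.
  exists x, (ball u (d / 2)) => // y [_ uy].
  rewrite -ball_normE /=; apply: Td; rewrite linearB.
  have := ball_splitr ux uy.
  by rewrite -ball_normE.
exists x0.
  have F_ball : F (closed_unit_ball X).
    by exists setT; [exact: filterT | move=> x []].
  exact: (closed_cvg (u_ := id) _ (closed_closed_unit_ball X) F_ball _ Fx0).
(* Along [F], [T] tends to [u] by construction and to [T x0] by continuity; limits in [Y] are
   unique. *)
have TFu : T x @[x --> F] --> u by move=> A uA; exists A => // x [].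
apply: (cvg_unique (@norm_hausdorff _ _) _ TFu).
by apply: cvg_trans (Tmono.1 x0); exact: cvg_app.
Qed.

(** A general [K] covers the scalars [R] and [R[i]] at once. *)
Lemma QNA_monomorphism_NA {K : numFieldType} {X : completeNormedModType K}
    {Y : normedModType K} {T : {linear X -> Y}} :
  QNA X Y T -> monomorphism T -> NA X Y T.
Proof.
move=> [T_bdd [u [u_adh u_norm]]] /closed_monomorphism_image_ball.
move=> /(_ _ u_adh)[x0 x01 Tx0].
by split=> //; exists x0; rewrite Tx0.
Qed.

Theorem lemma2p5 (R : realType) :
  (forall (X Y : completeNormedModType R) (T : {linear X -> Y}),
     QNA X Y T -> monomorphism T -> NA X Y T) /\
  (forall (X Y : completeNormedModType R[i]) (T : {linear X -> Y}),
     QNA X Y T -> monomorphism T -> NA X Y T).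
Proof. by split=> X Y T; exact: QNA_monomorphism_NA. Qed.
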